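(* Let $T\in\mathcal{L}(\mathcal{H})$ have closed range and let $n\geq 1$ be an integer. The following statements are equivalent: (i) $T$ is $n$-hypo-EP; (ii) $T^\dagger T^{n+1}T^*T=T^nT^*T$; (iii) $T^\dagger T^{n+1}T^*=T^nT^*$. In particular, the following conditions are equivalent: (i') $T$ is hypo-EP; (ii') $T^\dagger T^2T^*T=TT^*T$; (iii') $T^\dagger T^2T^*=TT^*$.
   Context: $\mathcal{H}$ is a complex Hilbert space, $\mathcal{L}(\mathcal{H})$ is the algebra of bounded linear operators on $\mathcal{H}$, $R(\cdot)$ denotes range, and $[A,B]=AB-BA$. For $T\in\mathcal{L}(\mathcal{H})$ with closed range, the Moore-Penrose inverse $T^\dagger$ is the unique operator with $TT^\dagger T=T$, $T^\dagger TT^\dagger=T^\dagger$, $(T^\dagger T)^*=T^\dagger T$, $(TT^\dagger)^*=TT^\dagger$. A closed range operator $T$ is hypo-EP if $[T^\dagger,T]\geq 0$, and is $n$-hypo-EP if $R(T^n)\subseteq R(T^* )$. *)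

(* Defs.v *)
From HB Require Import structures.
From mathcomp Require Import all_boot all_order all_algebra.
From mathcomp Require Import complex.
From mathcomp Require Import all_classical all_reals all_analysis.

Set Implicit Arguments.
Unset Strict Implicit.
Unset Printing Implicit Defensive.

Import Order.TTheory GRing.Theory Num.Theory.
Import numFieldNormedType.Exports.

Local Open Scope classical_set_scope.
Local Open Scope ring_scope.

(* Inner products are linear in the first argument and conjugate-linear in the
   second.  Completeness comes from completeNormedModType, whose norm is
   required to be the one induced by the inner product. *)
HB.mixin Record NormedModule_isHilbert (R : realType) H
    of CompleteNormedModule R[i] H := {
  hdot : {dot H for (@Num.conj R[i])} ;
  hdot_norm : forall x : H, `|x| ^+ 2 = hdot x x
}.

#[short(type="hilbertType")]
HB.structure Definition Hilbert (R : realType) :=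
  { H of NormedModule_isHilbert R H & CompleteNormedModule R[i] H }.

Section BoundedOperators.
Variables (R : realType) (H : hilbertType R).

Definition bounded_linear : {pred H -> H} :=
  [pred f | `[< linear f /\ exists M : R[i], forall x, `|f x| <= M * `|x| >]].

Record bop := Bop { bop_fun :> H -> H; bop_funP : bop_fun \in bounded_linear }.

HB.instance Definition _ := [isSub for bop_fun].
HB.instance Definition _ := [Choice of bop by <:].

Lemma bounded_linear_zmod_closed : zmod_closed bounded_linear.
Proof.
split=> [|f g /asboolP[lf [M fM]] /asboolP[lg [N gN]]]; apply/asboolP; split.
- by move=> a x y; rewrite /= scaler0 addr0.
- by exists 0 => x; rewrite normr0 mul0r.
- move=> a x y; rewrite !fctE lf lg scalerBr opprD -!addrA; congr (_ + _).
  by rewrite addrCA.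
- exists (M + N) => x; rewrite !fctE mulrDl (le_trans (ler_normB _ _))//.
  by rewrite lerD.
Qed.

HB.instance Definition _ := GRing.isZmodClosed.Build (H -> H) bounded_linear
  bounded_linear_zmod_closed.
HB.instance Definition _ := [SubChoice_isSubZmodule of bop by <:].

Lemma bop_linear (f : bop) : linear f.
Proof. by case: f => f /= /asboolP[]. Qed.

HB.instance Definition _ (f : bop) :=
  GRing.isLinear.Build R[i] H H *:%R f (bop_linear f).

Lemma bop_bounded (f : bop) :
  exists2 M : R[i], 0 <= M & forall x, `|f x| <= M * `|x|.
Proof.
case: f => f /= /asboolP[lf [M fM]].
have [[x x0]|H0] := pselect (exists x : H, x != 0).
  exists M => //.
  have := le_trans (normr_ge0 _) (fM x).
  by rewrite pmulr_lge0 // normr_gt0.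
exists 0 => // x; suff -> : f x = 0 by rewrite normr0 mul0r.
by apply: contra_notP H0 => /eqP fx0; exists (f x).
Qed.

Lemma bop_id_subproof : (fun x : H => x) \in bounded_linear.
Proof. by apply/asboolP; split=> //; exists 1 => x; rewrite mul1r. Qed.

Lemma bop_comp_subproof (f g : bop) :
  (fun x : H => f (g x)) \in bounded_linear.
Proof.
apply/asboolP; split=> [a x y|]; first by rewrite !linearP.
have [M M0 fM] := bop_bounded f; have [N N0 gN] := bop_bounded g.
exists (M * N) => x; rewrite (le_trans (fM _))// -mulrA.
by rewrite ler_wpM2l.
Qed.

Definition bop_id := Bop bop_id_subproof.
Definition bop_comp (f g : bop) := Bop (bop_comp_subproof f g).

Fact bop_compA : associative bop_comp.
Proof. by move=> f g h; apply/val_inj. Qed.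
Fact bop_comp1f : left_id bop_id bop_comp.
Proof. by move=> f; apply/val_inj. Qed.
Fact bop_compf1 : right_id bop_id bop_comp.
Proof. by move=> f; apply/val_inj. Qed.
Fact bop_compDl : left_distributive bop_comp +%R.
Proof. by move=> f g h; apply/val_inj. Qed.
Fact bop_compDr : right_distributive bop_comp +%R.
Proof.
by move=> f g h; apply/val_inj/funext => x /=; rewrite !fctE linearD.
Qed.

(* The ring product is composition; the ring need not be nontrivial since the
   zero space is allowed. *)
HB.instance Definition _ := GRing.Zmodule_isPzRing.Build bop
  bop_compA bop_comp1f bop_compf1 bop_compDl bop_compDr.

End BoundedOperators.

Notation "''L' ( H )" := (bop H) (at level 0, format "''L' ( H )") : type_scope.

Section MoorePenrose.
Variables (R : realType) (H : hilbertType R).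
Implicit Types S T A B : 'L(H).

Definition is_adjoint T S : Prop := forall x y : H, hdot (T x) y = hdot x (S y).

(* xget selects an element of the set, here a singleton by the Riesz
   representation theorem; 0 is only the value on the empty set. *)
Definition adjoint T : 'L(H) := xget 0 [set S | is_adjoint T S].

Definition closed_range T : Prop := closed (range T).

Definition is_moore_penrose T S : Prop :=
  [/\ T * S * T = T, S * T * S = S,
      adjoint (S * T) = S * T & adjoint (T * S) = T * S].

(* The set is a singleton exactly when T has closed range. *)
Definition mpinv T : 'L(H) := xget 0 [set S | is_moore_penrose T S].

Definition commutator A B : 'L(H) := A * B - B * A.

(* On R[i], 0 <= z means that z is real and nonnegative. *)
Definition positive_op A : Prop := forall x : H, 0 <= hdot (A x) x.

Definition hypo_EP T : Prop :=
  closed_range T /\ positive_op (commutator (mpinv T) T).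

Definition n_hypo_EP (n : nat) T : Prop :=
  closed_range T /\ range (T ^+ n) `<=` range (adjoint T).

End MoorePenrose.

(* Main.v *)
Require Import Defs.
From mathcomp Require Import all_boot all_order all_algebra.
From mathcomp Require Import complex.
From mathcomp Require Import all_classical all_reals all_analysis.
From mathcomp Require Import ring.

Set Implicit Arguments.
Unset Strict Implicit.
Unset Printing Implicit Defensive.

Import Order.TTheory GRing.Theory Num.Theory.
Import numFieldNormedType.Exports.

Local Open Scope classical_set_scope.
Local Open Scope ring_scope.

(** Write S for the Moore-Penrose inverse of T.  P = S T and Q = T S are the
orthogonal projections onto the ranges of T* and of T.  All the conditions say
that P T^n = T^n, with n = 1 in the hypo-EP case:
- the range of T^n lies in that of T* exactly when P fixes it
  ([n_hypo_EP_mpinv]);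
- T* can be cancelled on the right of P T^n T* = T^n T*, because T* S* = P and
  T^n P = T^n for n >= 1 ([mpinv_fix_expr_adjoint]);
- T can be cancelled on the right of an equation between operators of the form
  X T* T, because T* T S = T* ([adjointM_cancel_r]);
- hypo-EP means P - Q >= 0, which for orthogonal projections means P Q = Q
  ([positive_projB]), that is P T = T.

These cancellations are pure algebra in the ring of bounded operators, but they
use that the adjoint and the Moore-Penrose inverse satisfy their defining
equations, and this is where the analysis lies.  Completeness gives orthogonal
projections onto closed subspaces ([projection_theorem]), these give Riesz
representation, and Riesz representation gives adjoints.

For the Moore-Penrose inverse, let Q now be the orthogonal projection onto the
closed range of T, and A = T T* + (1 - Q).  The operator A is self-adjoint, and
it is invertible as soon as it is bounded below.  The first summand lives on the
range of T and the second on its orthogonal complement, so this reduces to T*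
being bounded below on the range of T.  That is the uniform boundedness
principle for the vectors w = Q w with |T* w| <= 1: for each z, writing
Q z = T x, one has |<z, w>| = |<x, T* w>| <= |x|.  As A commutes with Q and
Q A = T T*, the operator T* A^-1 satisfies the four Penrose equations
([moore_penrose_exists]). *)

(** * Inner product geometry *)

Section InnerProduct.
Variables (R : realType) (H : hilbertType R).
Local Notation C := R[i].
Local Notation "''[' u , v ]" := (hdot u v) : ring_scope.
Implicit Types (u v w z : H) (a e : C).

Lemma hdotC u v : '[u, v] = ('[v, u])^*.
Proof. by rewrite hermC mul1r. Qed.

Lemma hdotDl u v w : '[u + v, w] = '[u, w] + '[v, w].
Proof. exact: linearDl. Qed.
Lemma hdotDr u v w : '[u, v + w] = '[u, v] + '[u, w].
Proof. exact: linearDr. Qed.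
Lemma hdotBl u v w : '[u - v, w] = '[u, w] - '[v, w].
Proof. exact: linearBl. Qed.
Lemma hdotBr u v w : '[u, v - w] = '[u, v] - '[u, w].
Proof. exact: linearBr. Qed.
Lemma hdotZl a u v : '[a *: u, v] = a * '[u, v].
Proof. by rewrite linearZl_LR. Qed.
Lemma hdotZr a u v : '[u, a *: v] = a^* * '[u, v].
Proof. by rewrite linearZr_LR. Qed.
Lemma hdot0l u : '[0, u] = 0.
Proof. exact: linear0l. Qed.
Lemma hdot0r u : '[u, 0] = 0.
Proof. exact: linear0r. Qed.

Lemma hdot_ext u v : (forall z, '[u, z] = '[v, z]) -> u = v.
Proof.
move=> uv; apply/eqP; rewrite -subr_eq0 -normr_eq0 -sqrf_eq0 hdot_norm.
by rewrite hdotBl uv subrr.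
Qed.

Lemma normBZ_sqr u v a : `|u - a *: v| ^+ 2 =
  `|u| ^+ 2 - (a^* * '[u, v] + a * '[v, u]) + `|a| ^+ 2 * `|v| ^+ 2.
Proof.
rewrite !hdot_norm hdotBl !hdotBr !hdotZl !hdotZr normCK; ring.
Qed.

(** If moving along v shortens u by little, then u is nearly orthogonal to v: the
best step, with coefficient <u, v> / |v|^2, shortens |u|^2 by
|<u, v>|^2 / |v|^2.  The slack e allows the bound to be used on the members of a
minimizing sequence, before any minimizer is known; e = |u|^2 gives the
Cauchy-Schwarz inequality. *)
Lemma near_minimal_orthogonal u v e :
  (forall a, `|u| ^+ 2 <= `|u - a *: v| ^+ 2 + e) ->
  `|'[u, v]| ^+ 2 <= e * `|v| ^+ 2.
Proof.
have [->|v0] := eqVneq v 0; first by rewrite hdot0r !normr0 expr0n mulr0.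
have nv0 : 0 < `|v| ^+ 2 by rewrite exprn_gt0 // normr_gt0.
have cv : (`|v| ^+ 2)^* = `|v| ^+ 2 by apply/conj_Creal/gtr0_real.
move=> /(_ ('[u, v] / `|v| ^+ 2)).
rewrite normBZ_sqr.
rewrite rmorphM /= fmorphV /= cv.
rewrite normrM normfV (ger0_norm (ltW nv0)) exprMn.
rewrite (hdotC v u) -!addrA lerDl normCK.
have -> : - ('[u, v]^* / `|v| ^+ 2 * '[u, v] + '[u, v] / `|v| ^+ 2 * '[u, v]^*)
  + ('[u, v] * '[u, v]^* * (`|v| ^+ 2)^-1 ^+ 2 * `|v| ^+ 2 + e) =
  e - ('[u, v] * '[u, v]^*) / `|v| ^+ 2.
  by field; rewrite normr_eq0.
by rewrite subr_ge0 ler_pdivrMr.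
Qed.

Lemma cauchy_schwarz u v : `|'[u, v]| <= `|u| * `|v|.
Proof.
rewrite -(@ler_pXn2r _ 2) ?nnegrE ?mulr_ge0// exprMn.
by apply: near_minimal_orthogonal => a; rewrite lerDr exprn_ge0.
Qed.

Lemma pythagoras u v : '[u, v] = 0 -> `|u + v| ^+ 2 = `|u| ^+ 2 + `|v| ^+ 2.
Proof.
move=> uv; rewrite !hdot_norm hdotDl !hdotDr (hdotC v u) uv.
by rewrite conjC0 addr0 add0r.
Qed.

Lemma norm_le_of_sqr u a : 0 <= a -> `|u| ^+ 2 <= a * `|u| -> `|u| <= a.
Proof.
move=> a0; have [->|u0] := eqVneq u 0; first by rewrite normr0.
by rewrite expr2 ler_pM2r ?normr_gt0.
Qed.

Lemma parallelogram u v :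
  `|u - v| ^+ 2 = 2 * `|u| ^+ 2 + 2 * `|v| ^+ 2 - `|u + v| ^+ 2.
Proof. by rewrite !hdot_norm hdotBl hdotDl !hdotBr !hdotDr; ring. Qed.

End InnerProduct.

(** * Completeness, orthogonal projection and uniform boundedness *)

Section Completeness.
Variables (R : realType) (H : hilbertType R).
Local Notation C := R[i].
Local Notation "''[' u , v ]" := (hdot u v) : ring_scope.
Implicit Types (x y z w : H) (a e : C).

Lemma half_expn_small e : 0 < e -> exists n, 2^-1 ^+ n < e.
Proof.
move=> e0.
have ereal : e = (complex.Re e)%:C%C by apply/esym/RRe_real/gtr0_real.
have r0 : 0 < complex.Re e by rewrite -ltcR -ereal.
exists (Num.truncn (complex.Re e)^-1).+1.
rewrite ereal.
have -> : 2^-1 ^+ (Num.truncn (complex.Re e)^-1).+1 =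
  (2^-1 ^+ (Num.truncn (complex.Re e)^-1).+1)%:C%C :> C.
  by rewrite rmorphXn /= fmorphV rmorph_nat.
rewrite ltcR exprVn invf_plt ?posrE ?exprn_gt0//.
apply: (lt_trans (truncnS_gt _)).
by rewrite -natrX ltr_nat ltn_expl.
Qed.

Lemma half_sqr n : (2^-1 ^+ n) ^+ 2 = 4^-1 ^+ n :> C.
Proof. by rewrite -exprM mulnC exprM exprVn -natrX. Qed.

Lemma geometric_small a e : 0 <= a -> 0 < e -> exists n, a * 2^-1 ^+ n < e.
Proof.
move=> a0 e0; have a1 : 0 < a + 1 by rewrite ltr_wpDl.
have [n hn] := half_expn_small (divr_gt0 e0 a1); exists n.
rewrite (@le_lt_trans _ _ ((a + 1) * 2^-1 ^+ n))//.
  by rewrite ler_wpM2r ?exprn_ge0// lerDl.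
by rewrite mulrC -ltr_pdivlMr.
Qed.

Lemma closed_normP (M : set H) : closed M ->
  forall x, (forall e, 0 < e -> exists2 m, M m & `|x - m| < e) -> M x.
Proof.
move=> clM x xM; apply: clM => B /nbhs_normP[e /= e0 eB].
by have [m Mm xm] := xM e e0; exists m; split => //; exact: eB.
Qed.

Lemma normP_closed (M : set H) :
  (forall x, (forall e, 0 < e -> exists2 m, M m & `|x - m| < e) -> M x) ->
  closed M.
Proof.
move=> clM x xM; apply: clM => e e0.
have [|m [Mm xm]] := xM (ball_ Num.Def.normr x e); last by exists m.
by apply/nbhs_normP; exists e.
Qed.

(** Completeness with an explicit rate, which passes to the limit. *)
Lemma cauchy_rate_limit (s : nat -> H) (r : nat -> C) :
  (forall e, 0 < e -> exists n, r n < e) ->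
  (forall n m, (n <= m)%N -> `|s m - s n| <= r n) ->
  exists x, forall n, `|x - s n| <= r n.
Proof.
move=> r0 hs.
have cs : cvg (s @ \oo).
  apply/cauchy_cvgP/cauchy_ballP => e e0.
  have [N hN] := r0 _ (divr_gt0 e0 (ltr0Sn C 1)).
  exists (s @` [set n | (N <= n)%N], s @` [set n | (N <= n)%N]) => /=.
    by split; exists N => // n /= Nn; exists n.
  move=> [_ _] /= [[p Np <-] [q Nq <-]].
  rewrite -ball_normE /=.
  have -> : s p - s q = (s p - s N) - (s q - s N) by rewrite opprB addrA subrK.
  apply: (le_lt_trans (ler_normB _ _)).
  apply: (le_lt_trans (lerD (hs _ _ Np) (hs _ _ Nq))).
  by rewrite -mulr2n -mulr_natr -ltr_pdivlMr.
exists (lim (s @ \oo)) => n.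
apply/ler_addgt0Pr => e e0.
have /cvgrPdist_le /(_ e e0) [N _ hN] : s @ \oo --> lim (s @ \oo) by [].
have := hN (maxn N n) (leq_maxl _ _) => /= h.
rewrite -(subrKA (s (maxn N n))) (le_trans (ler_normD _ _)) // addrC lerD //.
by apply: hs; rewrite leq_maxr.
Qed.

(** The norm takes its values in R[i], which has no infima of its own, but
nonnegative elements of R[i] are real. *)
Lemma complex_infimum (S : set C) : S !=set0 -> (forall s, S s -> 0 <= s) ->
  exists2 d : C, (forall s, S s -> d <= s) &
    forall e, 0 < e -> exists2 s, S s & s < d + e.
Proof.
move=> [s0 Ss0] S0.
have SRe s : S s -> s = (complex.Re s)%:C%C.
  by move=> Ss; apply/esym/RRe_real/ger0_real/S0.
have lb : lbound (@complex.Re R @` S) 0.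
  by move=> _ [s Ss <-]; rewrite -lecR -SRe// S0.
have hi : has_inf (@complex.Re R @` S).
  by split; [exists (complex.Re s0); exists s0 | exists 0].
exists (inf (@complex.Re R @` S))%:C%C => [s Ss|e e0].
  by rewrite (SRe _ Ss) lecR; apply: ge_inf; [exists 0 | exists s].
have ereal : e = (complex.Re e)%:C%C by apply/esym/RRe_real/gtr0_real.
have r0 : 0 < complex.Re e by rewrite -ltcR -ereal.
have [_ [s Ss <-] hs] := inf_adherent r0 hi.
by exists s => //; rewrite (SRe _ Ss) ereal -rmorphD ltcR.
Qed.

(** The classical proof: by the parallelogram identity a minimizing sequence of
the distance from x to M is Cauchy.  Orthogonality of x - p is obtained from the
near-orthogonality of the minimizing sequence, which spares the proof that p
attains the distance. *)
Lemma projection_theorem (M : set H) : closed M -> M 0 ->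
  (forall a x y, M x -> M y -> M (a *: x + y)) ->
  forall x, exists2 p, M p & forall z, M z -> '[x - p, z] = 0.
Proof.
move=> clM M0 MP x.
have [d dle dinf] : exists2 d : C, (forall m, M m -> d <= `|x - m| ^+ 2) &
    forall e, 0 < e -> exists2 m, M m & `|x - m| ^+ 2 < d + e.
  have [||d dle dinf] := @complex_infimum [set `|x - m| ^+ 2 | m in M].
  - by exists (`|x - 0| ^+ 2); exists 0.
  - by move=> _ [m _ <-]; exact: exprn_ge0.
  exists d => [m Mm|e e0]; first by apply: dle; exists m.
  by have [_ [m Mm <-] ?] := dinf e e0; exists m.
have /choice[s hs] : forall n, exists m, M m /\ `|x - m| ^+ 2 < d + 4^-1 ^+ n.
  move=> n; have [|m Mm hm] := dinf (4^-1 ^+ n); last by exists m.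
  by rewrite exprn_gt0 // invr_gt0.
have Cs n m : (n <= m)%N -> `|s m - s n| <= 2 * 2^-1 ^+ n.
  move=> nm.
  have [Mn dn] := hs n; have [Mm dm] := hs m.
  (* The trailing 0 gives the midpoint the shape a *: x + y of MP. *)
  have h : 4 * d <= `|(x - s n) + (x - s m)| ^+ 2.
    have -> : (x - s n) + (x - s m) = 2 *: (x - (2^-1 *: s n + (2^-1 *: s m + 0))).
      rewrite addr0 !(scalerBr, scalerDr) !scalerA divff// !scale1r.
      by rewrite scalerDl scale1r opprD addrACA.
    rewrite normrZ exprMn normr_nat -natrX ler_pM2l //.
    apply: dle.
    by apply/MP => //; exact: MP.
  rewrite -(@ler_pXn2r _ 2) ?nnegrE ?mulr_ge0// ?exprn_ge0//.
  have -> : s m - s n = (x - s n) - (x - s m) by rewrite opprB [RHS]addrC subrKA.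
  rewrite parallelogram.
  have e4 : (4^-1 ^+ m : C) <= 4^-1 ^+ n.
    by rewrite ler_wiXn2l// ?invr_ge0// invf_le1// ler1n.
  have -> : (2 * 2^-1 ^+ n : C) ^+ 2 = 4 * 4^-1 ^+ n.
    by rewrite exprMn half_sqr -natrX.
  apply: (@le_trans _ _ (2 * (d + 4^-1 ^+ n) + 2 * (d + 4^-1 ^+ m) - 4 * d)).
    apply: lerD; last by rewrite lerN2.
    by apply: lerD; rewrite ler_pM2l// ltW.
  have -> : 2 * (d + 4^-1 ^+ n) + 2 * (d + 4^-1 ^+ m) - 4 * d =
    2 * 4^-1 ^+ n + 2 * 4^-1 ^+ m by ring.
  have -> : 4 * 4^-1 ^+ n = 2 * 4^-1 ^+ n + 2 * 4^-1 ^+ n :> C by ring.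
  by rewrite lerD2l ler_pM2l.
have small e (e0 : 0 < e) := geometric_small (ler0n C 2) e0.
have [p hp] := cauchy_rate_limit small Cs.
have Mp : M p.
  apply: (closed_normP clM) => e e0.
  have [n hn] := small e e0.
  by exists (s n); [case: (hs n) | exact: le_lt_trans hn].
exists p => // z Mz; apply/eqP; rewrite -normr_eq0 eq_le normr_ge0 andbT.
have hn n : `|'[x - p, z]| <= (3 * `|z|) * 2^-1 ^+ n.
  have [Mn dn] := hs n.
  have -> : x - p = (x - s n) - (p - s n) by rewrite opprB addrA subrK.
  rewrite hdotBl (le_trans (ler_normB _ _))//.
  have -> : 3 * `|z| * 2^-1 ^+ n = `|z| * 2^-1 ^+ n + 2 * 2^-1 ^+ n * `|z| by ring.
  apply: lerD; last first.
    apply: (le_trans (cauchy_schwarz _ _)).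
    by rewrite ler_wpM2r.
  rewrite -(@ler_pXn2r _ 2) ?nnegrE ?mulr_ge0// ?exprn_ge0//.
  rewrite exprMn mulrC half_sqr.
  apply: near_minimal_orthogonal => a.
  apply: (le_trans (ltW dn)); rewrite lerD2r.
  rewrite -addrA -opprD; apply: dle.
  by rewrite addrC; apply: MP.
apply/ler_addgt0Pr => e e0; rewrite add0r.
have z0 : 0 <= 3 * `|z| by rewrite mulr_ge0.
have [n /ltW] := geometric_small z0 e0; exact: le_trans.
Qed.

(** Uniform boundedness for the functionals <., w>, by a gliding hump
argument.  If the w n have norms above 2 * 8^n, a
point s n is built by steps of length at most 4^-n such that
|<s n, w n>| >= 4^-n |w n|.  The steps after the n-th add up to at most 4^-n / 3, too
little to undo this, so the limit x has |<x, w n>| >= 2^n. *)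
Lemma weakly_bounded_bounded (W : set H) :
  (forall z, exists M : C, forall w, W w -> `|'[z, w]| <= M) ->
  exists M : C, forall w, W w -> `|w| <= M.
Proof.
move=> wW; apply: contrapT => unb.
have /choice[w hw] : forall n, exists w, W w /\ 2 * 8 ^+ n < `|w|.
  move=> n; apply: contrapT => h; apply: unb; exists (2 * 8 ^+ n) => w Ww.
  rewrite real_leNgt ?ger0_real ?mulr_ge0 ?exprn_ge0//.
  by apply/negP => hw; apply: h; exists w.
have w0 n : 0 < `|w n|.
  by apply: lt_trans (hw n).2; rewrite mulr_gt0 ?exprn_gt0.
(* One of y + u and y - u is a good next point, as <2 u, w n> = 2 * 4^-n |w n|. *)
have step (ny : nat * H) : exists y', `|y' - ny.2| <= 4^-1 ^+ ny.1 /\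
    4^-1 ^+ ny.1 * `|w ny.1| <= `|'[y', w ny.1]|.
  case: ny => n y /=; set c := 4^-1 ^+ n.
  have c0 : 0 < c by rewrite exprn_gt0 ?invr_gt0.
  pose u := (c / `|w n|) *: w n.
  have nu : `|u| = c.
    by rewrite normrZ normrM normfV normr_id divfK ?gt_eqF// gtr0_norm.
  have uw : '[u, w n] = c * `|w n|.
    rewrite hdotZl -hdot_norm expr2 mulrA divfK// gt_eqF//.
  have [h|h] := boolP (c * `|w n| <= `|'[y + u, w n]|).
    by exists (y + u); rewrite addrC addKr nu.
  exists (y - u); rewrite addrC addKr normrN nu; split => //.
  have cw : 0 <= c * `|w n| by rewrite mulr_ge0// ltW.
  have : c * `|w n| + c * `|w n| <= `|'[y + u, w n]| + `|'[y - u, w n]|.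
    apply: le_trans (ler_normB _ _); rewrite -hdotBl.
    have -> : y + u - (y - u) = u + u by rewrite opprB addrC subrKA.
    by rewrite hdotDl uw ger0_norm ?addr_ge0.
  move: h; rewrite -real_ltNge ?ger0_real// => h.
  by apply: contraTT; rewrite -!real_ltNge ?ger0_real ?addr_ge0// => h'; exact: ltrD.
have [F hF] := choice step.
pose s := fix s n := F (n, if n is n'.+1 then s n' else 0).
have sw n : 4^-1 ^+ n * `|w n| <= `|'[s n, w n]| by case: n => [|n]; apply: (hF _).2.
have sS n : `|s n.+1 - s n| <= 4^-1 ^+ n.+1 by exact: (hF _).1.
have sC n m : (n <= m)%N -> `|s m - s n| <= 2^-1 * 4^-1 ^+ n.
  move=> /subnK <-; move: (m - n)%N => k.
  (* The bound (4^-n - 4^-m) / 3 is what telescopes; 1/2 is a rounder constant. *)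
  apply: (@le_trans _ _ (3^-1 * (4^-1 ^+ n - 4^-1 ^+ (k + n)))); last first.
    rewrite mulrBr lerBlDr -[leLHS]addr0 lerD ?mulr_ge0 ?exprn_ge0//.
    by rewrite ler_pM2r ?exprn_gt0// lef_pV2 ?posrE// ler_nat.
  elim: k => [|k IH]; first by rewrite !subrr normr0 mulr0.
  rewrite addSn -(subrKA (s (k + n)%N)) (le_trans (ler_normD _ _))//.
  apply: (le_trans (lerD (sS _) IH)).
  by rewrite le_eqVlt; apply/orP; left; apply/eqP; rewrite exprS; field.
have small e : 0 < e -> exists n, 2^-1 * 4^-1 ^+ n < e.
  move=> e0; have [n hn] := half_expn_small e0.
  exists n; apply: le_lt_trans hn.
  rewrite -half_sqr expr2 -[leRHS]mul1r ler_pM ?mulr_ge0 ?exprn_ge0//.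
    by rewrite invf_le1// ler1n.
  by rewrite ler_piMl ?exprn_ge0// exprn_ile1 ?invr_ge0// invf_le1// ler1n.
have [x hx] := cauchy_rate_limit small sC.
have [M hM] := wW x.
have xw n : 2 ^+ n <= `|'[x, w n]|.
  have -> : x = s n - (s n - x) by rewrite subKr.
  rewrite hdotBl (le_trans _ (lerB_dist _ _))// lerBrDr.
  apply: le_trans (sw n).
  apply: (@le_trans _ _ (2 ^+ n + 2^-1 * 4^-1 ^+ n * `|w n|)).
    rewrite lerD2l (le_trans (cauchy_schwarz _ _))// ler_wpM2r//.
    by rewrite distrC.
  have -> : 4^-1 ^+ n * `|w n| =
    2^-1 * 4^-1 ^+ n * `|w n| + 2^-1 * 4^-1 ^+ n * `|w n| by field.
  rewrite lerD2r.
  have -> : 2 ^+ n = 2^-1 * 4^-1 ^+ n * (2 * 8 ^+ n) :> C.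
    rewrite mulrACA mulVf// mul1r -exprMn; congr (_ ^+ _).
    by rewrite -[8]/((4 * 2)%:R) natrM mulKf.
  rewrite ler_pM2l ?mulr_gt0 ?exprn_gt0 ?invr_gt0//.
  exact/ltW/(hw n).2.
have M0 : 0 < M.
  by apply: lt_le_trans (hM _ (hw 0).1); apply: lt_le_trans (xw 0).
have MV0 : 0 < M^-1 by rewrite invr_gt0.
have [n] := half_expn_small MV0.
rewrite exprVn ltf_pV2 ?posrE ?exprn_gt0// => h.
have := lt_le_trans h (le_trans (xw n) (hM _ (hw n).1)).
by rewrite ltxx.
Qed.

End Completeness.

(** * Bounded operators and their adjoints *)

Section Adjoints.
Variables (R : realType) (H : hilbertType R).
Local Notation C := R[i].
Local Notation "''[' u , v ]" := (hdot u v) : ring_scope.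
Implicit Types (x y z u v w : H) (a b : C) (S T : 'L(H)).

Lemma bop_of_bound (f : H -> H) b : linear f ->
  (forall x, `|f x| <= b * `|x|) -> exists S : 'L(H), forall x, S x = f x.
Proof.
move=> lf fb; have fP : f \in @bounded_linear R H.
  by apply/asboolP; split => //; exists b.
by exists (Bop fP).
Qed.

Lemma mulopE S T x : (S * T) x = S (T x).
Proof. by []. Qed.

Lemma addopE S T x : (S + T) x = S x + T x.
Proof. by []. Qed.

Lemma subopE S T x : (S - T) x = S x - T x.
Proof. by []. Qed.

Lemma bopB S x y : S (x - y) = S x - S y.
Proof. exact: linearB. Qed.

Lemma bopP S a x y : S (a *: x + y) = a *: S x + S y.
Proof. exact: linearP. Qed.

Lemma bop_ext S T : (forall x, S x = T x) -> S = T.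
Proof. by move=> ST; apply/val_inj/funext. Qed.

Lemma hdot_bop_ext S T : (forall x y, '[S x, y] = '[T x, y]) -> S = T.
Proof. by move=> ST; apply: bop_ext => x; apply: hdot_ext => y. Qed.

(** A vector u orthogonal to the kernel of f represents f up to a factor, because
x - (f x / f u) u lies in the kernel. *)
Lemma riesz_representation (f : H -> C) b :
  (forall a x y, f (a *: x + y) = a * f x + f y) ->
  (forall x, `|f x| <= b * `|x|) -> exists y, forall x, f x = '[x, y].
Proof.
move=> fP fb.
have f0 : f 0 = 0.
  by have := fP (-1) 0 0; rewrite scaler0 addr0 mulN1r addNr.
have fB x y : f (x - y) = f x - f y.
  by rewrite addrC -scaleN1r fP mulN1r addrC.
have clK : closed [set x | f x = 0].
  apply: normP_closed => x xM /=.
  apply/eqP; rewrite -normr_eq0 eq_le normr_ge0 andbT.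
  apply/ler_addgt0Pr => e e0; rewrite add0r.
  have [x0|x0] := eqVneq x 0; first by rewrite x0 f0 normr0 ltW.
  have b0 : 0 <= b.
    by have := le_trans (normr_ge0 _) (fb x); rewrite pmulr_lge0// normr_gt0.
  have b1 : 0 < b + 1 by rewrite ltr_wpDl.
  have [m /= fm0] := xM _ (divr_gt0 e0 b1).
  rewrite ltr_pdivlMr// => /ltW; apply: le_trans.
  rewrite -[f x]subr0 -fm0 -fB (le_trans (fb _))// mulrC ler_wpM2l//.
  by rewrite lerDl.
have [fz|/existsNP[x0 fx0]] := pselect (forall x, f x = 0).
  by exists 0 => x; rewrite hdot0r.
have [|a x y /= fx fy|p /= fp xp] := projection_theorem clK _ _ x0 => //.
  by rewrite fP fx fy mulr0 addr0.
set u := x0 - p in xp.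
have fu : f u != 0 by rewrite fB fp subr0; exact/eqP.
have uu : '[u, u] != 0.
  rewrite -hdot_norm sqrf_eq0 normr_eq0; apply: contraNneq fu => ->.
  by rewrite f0.
exists (((f u) / '[u, u])^* *: u) => x.
have /xp : f (x - (f x / f u) *: u) = 0.
  by rewrite addrC -scaleNr fP mulNr divfK// addNr.
rewrite hdotC => /eqP; rewrite conjC_eq0 hdotBl hdotZl subr_eq0 => /eqP xu.
by rewrite hdotZr conjCK xu; field; rewrite fu uu.
Qed.

Lemma adjoint_exists T : exists S, is_adjoint T S.
Proof.
have [b b0 Tb] := bop_bounded T.
have /choice[f hf] y : exists z, forall x, '[T x, y] = '[x, z].
  apply: (riesz_representation (f:=fun x => '[T x, y]) (b:=b * `|y|)).
    by move=> a u v; rewrite linearP hdotDl hdotZl.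
  move=> x; rewrite (le_trans (cauchy_schwarz _ _))// mulrAC.
  by rewrite ler_wpM2r.
have [||S hS] := bop_of_bound (f:=f) (b:=b).
- move=> a u v; apply: hdot_ext => z.
  rewrite hdotC -hf hdotDr hdotZr hdotDl hdotZl !hf rmorphD rmorphM /= conjCK.
  by rewrite -!hdotC.
- (* |S x|^2 = <T S x, x>, so a bound for T is a bound for S. *)
  move=> x; apply: norm_le_of_sqr; first by rewrite mulr_ge0.
  rewrite hdot_norm -hf -[leLHS]ger0_norm; last by rewrite hf -hdot_norm exprn_ge0.
  rewrite (le_trans (cauchy_schwarz _ _))// mulrAC ler_wpM2r//.
by exists S => x y; rewrite hS hf.
Qed.

Lemma adjointP T x y : '[T x, y] = '[x, adjoint T y].
Proof.
have [S hS] := adjoint_exists T.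
by move: x y; apply: (@xgetPex _ 0 [set S | is_adjoint T S]); exists S.
Qed.

Lemma adjointPr T x y : '[adjoint T x, y] = '[x, T y].
Proof. by rewrite hdotC -adjointP -hdotC. Qed.

Lemma adjoint_unique T S : (forall x y, '[T x, y] = '[x, S y]) -> adjoint T = S.
Proof.
by move=> TS; apply: hdot_bop_ext => x y; rewrite adjointPr hdotC TS -hdotC.
Qed.

Lemma adjointK T : adjoint (adjoint T) = T.
Proof. by apply: adjoint_unique => x y; rewrite adjointPr. Qed.

Lemma adjointM S T : adjoint (S * T) = adjoint T * adjoint S.
Proof. by apply: adjoint_unique => x y; rewrite !mulopE !adjointP. Qed.

Lemma adjointD S T : adjoint (S + T) = adjoint S + adjoint T.
Proof.
by apply: adjoint_unique => x y; rewrite !addopE hdotDl hdotDr !adjointP.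
Qed.

Lemma adjointB S T : adjoint (S - T) = adjoint S - adjoint T.
Proof.
by apply: adjoint_unique => x y; rewrite !subopE hdotBl hdotBr !adjointP.
Qed.

Lemma adjoint1 : adjoint (1 : 'L(H)) = 1.
Proof. by apply: adjoint_unique. Qed.

Lemma orthogonal_projection (M : set H) : closed M -> M 0 ->
  (forall a x y, M x -> M y -> M (a *: x + y)) ->
  exists P : 'L(H), [/\ forall x, M (P x), forall x, M x -> P x = x &
    adjoint P = P].
Proof.
move=> clM M0 MP.
have /choice[f hf] x : exists p, M p /\ forall z, M z -> '[x - p, z] = 0.
  by have [p Mp xp] := projection_theorem clM M0 MP x; exists p.
have fE x p : M p -> (forall z, M z -> '[x - p, z] = 0) -> f x = p.
  move=> Mp xp; have [Mf xf] := hf x.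
  have Mfp : M (f x - p).
    by rewrite addrC -scaleN1r; apply: MP.
  apply/eqP; rewrite -subr_eq0 -normr_eq0 -sqrf_eq0 hdot_norm.
  have {1}-> : f x - p = (x - p) - (x - f x) by rewrite opprB [RHS]addrC subrKA.
  by rewrite hdotBl xp// xf// subrr.
have fdot x z : M z -> '[f x, z] = '[x, z].
  by move=> Mz; apply/esym/eqP; rewrite -subr_eq0 -hdotBl (hf x).2.
have [||P hP] := bop_of_bound (f:=f) (b:=1).
- move=> a x y; apply: fE => [|z Mz].
    by apply: MP; [case: (hf x)|case: (hf y)].
  by rewrite hdotBl !hdotDl !hdotZl !fdot// subrr.
- move=> x; rewrite mul1r; apply: norm_le_of_sqr => //.
  rewrite hdot_norm fdot; last by case: (hf x).
  rewrite -[leLHS]ger0_norm ?cauchy_schwarz//.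
  by rewrite -(fdot x (f x) (hf x).1) -hdot_norm exprn_ge0.
exists P; split => [x|x Mx|]; rewrite ?hP; first by case: (hf x).
  by apply: fE => // z _; rewrite subrr hdot0l.
apply: adjoint_unique => x y; rewrite !hP.
have [[Mx _] [My _]] := (hf x, hf y).
by rewrite -(fdot x) // [RHS]hdotC (fdot y) // -hdotC.
Qed.

Definition orthoproj (P : 'L(H)) : Prop := adjoint P = P /\ P * P = P.

Lemma orthoproj1B P : orthoproj P -> orthoproj (1 - P).
Proof.
move=> [Padj PP]; split; first by rewrite adjointB adjoint1 Padj.
by rewrite mulrBr mulr1 mulrBl mul1r PP subrr subr0.
Qed.

Lemma orthoproj_dot P x : orthoproj P -> '[P x, x] = `|P x| ^+ 2.
Proof.
move=> [Padj PP].
by rewrite hdot_norm [RHS]adjointP Padj -mulopE PP adjointP Padj.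
Qed.

Lemma orthoproj_norm P x : orthoproj P ->
  `|x| ^+ 2 = `|P x| ^+ 2 + `|(1 - P) x| ^+ 2.
Proof.
move=> [Padj PP]; rewrite -pythagoras; last first.
  by rewrite adjointP Padj -mulopE mulrBr mulr1 PP subrr hdot0r.
by rewrite -addopE addrC subrK.
Qed.

(** If P - Q >= 0 and Q x = x, then |P x|^2 >= |x|^2, and a projection that does
not shorten x fixes it.  Conversely, P Q = Q = Q P makes P - Q an orthogonal
projection. *)
Lemma positive_projB P Q : orthoproj P -> orthoproj Q ->
  positive_op (P - Q) <-> P * Q = Q.
Proof.
move=> Pproj Qproj; have [[Padj PP] [Qadj QQ]] := (Pproj, Qproj).
split=> [pos|PQ].
  apply: bop_ext => y; rewrite mulopE; set x := Q y.
  have Qx : Q x = x by rewrite -mulopE QQ.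
  have := pos x; rewrite subopE hdotBl Qx subr_ge0 orthoproj_dot// -hdot_norm.
  rewrite (orthoproj_norm x Pproj) gerDl => Px0.
  apply/eqP; rewrite eq_sym -subr_eq0 -[x in x - _]/((1 : 'L(H)) x) -subopE.
  by rewrite -normr_eq0 -sqrf_eq0 eq_le Px0 exprn_ge0.
have QP : Q * P = Q by rewrite -Qadj -{1}Padj -adjointM PQ.
move=> x; rewrite orthoproj_dot ?exprn_ge0//; split.
  by rewrite adjointB Padj Qadj.
by rewrite mulrBl !mulrBr PP PQ QP QQ subrr subr0.
Qed.

End Adjoints.

(** * Existence of the Moore-Penrose inverse *)

Section MoorePenroseInverse.
Variables (R : realType) (H : hilbertType R).
Local Notation C := R[i].
Local Notation "''[' u , v ]" := (hdot u v) : ring_scope.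
Implicit Types (x y z w : H) (a b : C) (A B S T : 'L(H)).

(** Preimages of a Cauchy sequence form a Cauchy sequence. *)
Lemma bounded_below_closed_range A b : 0 <= b ->
  (forall x, `|x| <= b * `|A x|) -> closed_range A.
Proof.
move=> b0 Ab; apply: normP_closed => x xA.
have /choice[y hy] n : exists y, `|x - A y| < 2^-1 ^+ n.
  have [|_ [y _ <-] h] := xA (2^-1 ^+ n); last by exists y.
  by rewrite exprn_gt0 ?invr_gt0.
have ym n m : (n <= m)%N -> `|y m - y n| <= b * 2 * 2^-1 ^+ n.
  move=> nm; rewrite (le_trans (Ab _))// -mulrA ler_wpM2l//.
  have -> : A (y m - y n) = (x - A (y n)) - (x - A (y m)).
    by rewrite bopB opprB [RHS]addrC subrKA.
  rewrite (le_trans (ler_normB _ _))// mulr_natl mulr2n lerD ?ltW//.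
  rewrite (lt_le_trans (hy m))//.
  by rewrite ler_wiXn2l// ?invr_ge0// invf_le1// ler1n.
have b2 : 0 <= b * 2 by rewrite mulr_ge0.
have [z hz] := cauchy_rate_limit (fun e e0 => geometric_small b2 e0) ym.
have [d d0 Ad] := bop_bounded A.
exists z => //.
apply/eqP; rewrite eq_sym -subr_eq0 -normr_eq0 eq_le normr_ge0 andbT.
apply/ler_addgt0Pr => e e0; rewrite add0r.
have c0 : 0 <= 1 + d * (b * 2) by rewrite addr_ge0// mulr_ge0.
have [n /ltW hn] := geometric_small c0 e0.
apply: le_trans hn.
have -> : x - A z = (x - A (y n)) - A (z - y n).
  by rewrite bopB opprB addrA subrK.
rewrite (le_trans (ler_normB _ _))// mulrDl mul1r lerD//; first exact: ltW.
by rewrite (le_trans (Ad _))// -mulrA ler_wpM2l.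
Qed.

Lemma range0 T : range T 0.
Proof. by exists 0 => //; exact: linear0. Qed.

Lemma rangeP T a x y : range T x -> range T y -> range T (a *: x + y).
Proof. by move=> [u _ <-] [v _ <-]; exists (a *: u + v); rewrite ?linearP. Qed.

(** The range is closed, and a vector orthogonal to it is killed by A* = A, hence
is zero. *)
Lemma selfadjoint_bounded_below_inverse A b : adjoint A = A -> 0 <= b ->
  (forall x, `|x| <= b * `|A x|) -> exists2 B, A * B = 1 & B * A = 1.
Proof.
move=> Aadj b0 Ab.
have clA := bounded_below_closed_range b0 Ab.
have A0 x : A x = 0 -> x = 0.
  move=> Ax; apply/eqP; rewrite -normr_eq0 eq_le normr_ge0 andbT.
  by rewrite (le_trans (Ab x))// Ax normr0 mulr0.
have /choice[f hf] x : exists y, A y = x.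
  have [_ [y _ <-] xy] := projection_theorem clA (range0 A) (@rangeP A) x.
  exists y; apply/esym/eqP; rewrite -subr_eq0; apply/eqP/A0/hdot_ext => z.
  by rewrite adjointP Aadj hdot0l; apply: xy; exists z.
have [||B hB] := bop_of_bound (f:=f) (b:=b).
- move=> a x y; apply/eqP; rewrite -subr_eq0; apply/eqP/A0.
  by rewrite bopB bopP !hf subrr.
- by move=> x; rewrite -[in leRHS](hf x).
exists B; apply: bop_ext => x; rewrite mulopE hB ?hf//.
by apply/eqP; rewrite -subr_eq0; apply/eqP/A0; rewrite bopB hf subrr.
Qed.

(** The vectors w in the range of T with |T* w| <= 1 form a weakly bounded set,
since <z, w> = <Q z, w> = <x, T* w> for any x with T x = Q z. *)
Lemma closed_range_adjoint_bounded_below T : closed_range T ->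
  exists2 b : C, 0 <= b & forall w, range T w -> `|w| <= b * `|adjoint T w|.
Proof.
move=> clT.
have [Q [Qr Qid Qadj]] := orthogonal_projection clT (range0 T) (@rangeP T).
have [|b hb] := weakly_bounded_bounded
  (W:=[set w | range T w /\ `|adjoint T w| <= 1]).
  move=> z; have [x _ Tx] := Qr z; exists `|x| => w [/Qid Qw Tw].
  rewrite -Qw -{1}Qadj -adjointP -Tx adjointP.
  by rewrite (le_trans (cauchy_schwarz _ _))// ler_piMr.
have b0 : 0 <= b.
  apply: le_trans (normr_ge0 0) (hb 0 _); split; first exact: range0.
  by rewrite linear0 normr0.
exists b => // w wT; have [Tw0|Tw0] := eqVneq (adjoint T w) 0.
  have [x _ xw] := wT.
  rewrite Tw0 normr0 mulr0; apply: norm_le_of_sqr => //.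
  by rewrite mul0r hdot_norm -{1}xw adjointP Tw0 hdot0r.
have Tw : 0 < `|adjoint T w| by rewrite normr_gt0.
have := hb (`|adjoint T w|^-1 *: w); rewrite normrZ normfV normr_id.
rewrite mulrC ler_pdivrMr//; apply; split.
  by rewrite -[_ *: w]addr0; exact: rangeP (range0 T).
by rewrite linearZ normrZ normfV normr_id mulVf// gt_eqF.
Qed.

(** T T* is invertible on the range of T only; adding the projection 1 - Q onto
the orthogonal complement makes it invertible on H, and T* = T* Q does not see
what was added. *)
Lemma moore_penrose_exists T : closed_range T -> exists S, is_moore_penrose T S.
Proof.
move=> clT.
have [Q [Qr Qid Qadj]] := orthogonal_projection clT (range0 T) (@rangeP T).
have QT : Q * T = T by apply: bop_ext => x; rewrite mulopE Qid//; exists x.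
have TQ : adjoint T * Q = adjoint T by rewrite -{1}Qadj -adjointM QT.
have QQ : Q * Q = Q by apply: bop_ext => x; rewrite mulopE Qid.
have Qproj : orthoproj Q by [].
have [b b0 Tb] := closed_range_adjoint_bounded_below clT.
pose A := T * adjoint T + (1 - Q).
have Aadj : adjoint A = A.
  by rewrite adjointD adjointB adjointM adjointK adjoint1 Qadj.
have Abelow x : `|x| <= (b ^+ 2 + 1) * `|A x|.
  have c0 : 0 <= (b ^+ 2 + 1) * `|A x| by rewrite mulr_ge0// addr_ge0// exprn_ge0.
  apply: norm_le_of_sqr => //.
  have dA : '[A x, x] = `|adjoint T x| ^+ 2 + `|(1 - Q) x| ^+ 2.
    rewrite addopE hdotDl mulopE adjointP -hdot_norm; congr (_ + _).
    exact/orthoproj_dot/orthoproj1B.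
  have QTx : `|Q x| ^+ 2 <= b ^+ 2 * `|adjoint T x| ^+ 2.
    by rewrite -exprMn ler_pXn2r ?nnegrE ?mulr_ge0// -TQ mulopE; exact: Tb.
  have Ax : `|'[A x, x]| = '[A x, x].
    by rewrite ger0_norm// dA addr_ge0// exprn_ge0.
  apply: (@le_trans _ _ ((b ^+ 2 + 1) * '[A x, x])); last first.
    rewrite -mulrA ler_wpM2l//; first by rewrite addr_ge0// exprn_ge0.
    by rewrite -Ax cauchy_schwarz.
  rewrite (orthoproj_norm x Qproj) dA mulrDr lerD//.
    by rewrite (le_trans QTx)// ler_wpM2r ?exprn_ge0// lerDl.
  by rewrite ler_peMl ?exprn_ge0// lerDr exprn_ge0.
have [B AB BA] := selfadjoint_bounded_below_inverse Aadj
  (addr_ge0 (exprn_ge0 2 b0) ler01) Abelow.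
have QA : Q * A = T * adjoint T.
  by rewrite mulrDr mulrA QT mulrBr mulr1 QQ subrr addr0.
have AQ : A * Q = T * adjoint T.
  by rewrite mulrDl -mulrA TQ mulrBl mul1r QQ subrr addr0.
have BQ : B * Q = Q * B.
  by rewrite -[B * Q]mulr1 -AB mulrA -(mulrA B) QA -AQ mulrA BA mul1r.
have Badj : adjoint B = B.
  by rewrite -[RHS]mul1r -adjoint1 -AB adjointM Aadj -mulrA AB mulr1.
have TS : T * (adjoint T * B) = Q by rewrite mulrA -QA -mulrA AB mulr1.
exists (adjoint T * B); split.
- by rewrite TS.
- by rewrite -mulrA TS -mulrA BQ mulrA TQ.
- by rewrite !adjointM adjointK Badj mulrA.
- by rewrite TS.
Qed.

Lemma mpinvP T : closed_range T -> is_moore_penrose T (mpinv T).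
Proof.
move=> /moore_penrose_exists[S hS].
by apply: (@xgetPex _ 0 [set S | is_moore_penrose T S]); exists S.
Qed.

End MoorePenroseInverse.

(** * The range conditions as operator equations *)

Section Conditions.
Variables (R : realType) (H : hilbertType R) (T : 'L(H)).
Variable clT : closed_range T.
Local Notation S := (mpinv T).

Lemma orthoproj_mpinvM : orthoproj (S * T).
Proof.
by have [_ STS Padj _] := mpinvP clT; split=> //; rewrite mulrA STS.
Qed.

Lemma orthoproj_Mmpinv : orthoproj (T * S).
Proof.
by have [TST _ _ Qadj] := mpinvP clT; split=> //; rewrite mulrA TST.
Qed.

Lemma mpinvM_adjoint : S * T * adjoint T = adjoint T.
Proof.
have [TST _ Padj _] := mpinvP clT.
by rewrite -Padj -adjointM mulrA TST.
Qed.

Lemma adjointM_mpinv : adjoint T * adjoint S = S * T.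
Proof. by have [_ _ Padj _] := mpinvP clT; rewrite -adjointM Padj. Qed.

Lemma adjoint_Mmpinv : adjoint T * (T * S) = adjoint T.
Proof.
have [TST _ _ Qadj] := mpinvP clT.
by rewrite -Qadj -adjointM TST.
Qed.

Lemma expr_mpinvM n : (1 <= n)%N -> T ^+ n * (S * T) = T ^+ n.
Proof.
have [TST _ _ _] := mpinvP clT.
by case: n => // n _; rewrite exprSr -mulrA (mulrA T) TST.
Qed.

(** S T is the orthogonal projection onto the range of T*. *)
Lemma n_hypo_EP_mpinv n : n_hypo_EP n T <-> S * T * T ^+ n = T ^+ n.
Proof.
split=> [[_ sub]|PT].
  apply: bop_ext => x; rewrite mulopE.
  have [|y _ <-] := sub ((T ^+ n) x); first by exists x.
  by rewrite -mulopE mpinvM_adjoint.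
split=> // _ [x _ <-]; exists (adjoint S ((T ^+ n) x)) => //.
by rewrite -mulopE adjointM_mpinv -mulopE PT.
Qed.

(** The commutator is S T - T S, and S T fixes the range of T S exactly when it
fixes that of T, as these ranges are the same. *)
Lemma hypo_EP_mpinv : hypo_EP T <-> S * T * T = T.
Proof.
have posE := positive_projB orthoproj_mpinvM orthoproj_Mmpinv.
have [TST _ _ _] := mpinvP clT.
split=> [[_ /posE PQ]|PT].
  have : S * T * (T * S) * T = T * S * T by rewrite PQ.
  by rewrite -(mulrA (S * T)) TST.
by split=> //; apply/posE; rewrite mulrA PT.
Qed.

(** Multiplication by S* on the right turns T* into S T, which T^n absorbs. *)
Lemma mpinv_fix_expr_adjoint n : (1 <= n)%N -> S * T * T ^+ n = T ^+ n <->
  S * T ^+ n.+1 * adjoint T = T ^+ n * adjoint T.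
Proof.
move=> n1; rewrite exprS mulrA; split=> [->//|PTT].
have : S * T * T ^+ n * (adjoint T * adjoint S) =
    T ^+ n * (adjoint T * adjoint S) by rewrite !mulrA PTT.
by rewrite adjointM_mpinv -(mulrA (S * T)) expr_mpinvM.
Qed.

Lemma adjointM_cancel_r (X Y : 'L(H)) :
  X * adjoint T * T = Y * adjoint T * T <-> X * adjoint T = Y * adjoint T.
Proof.
split=> [XY|->//].
by rewrite -adjoint_Mmpinv !mulrA XY.
Qed.

End Conditions.

Theorem corollary6 (R : realType) (H : hilbertType R) (T : 'L(H))
    (T_closed_range : closed_range T) :
  (forall n : nat, (1 <= n)%N ->
    [<-> n_hypo_EP n T;
         mpinv T * T ^+ n.+1 * adjoint T * T = T ^+ n * adjoint T * T;
         mpinv T * T ^+ n.+1 * adjoint T = T ^+ n * adjoint T]) /\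
  [<-> hypo_EP T;
       mpinv T * T ^+ 2 * adjoint T * T = T * adjoint T * T;
       mpinv T * T ^+ 2 * adjoint T = T * adjoint T].
Proof.
have main n (n1 : (1 <= n)%N) : [<-> mpinv T * T * T ^+ n = T ^+ n;
    mpinv T * T ^+ n.+1 * adjoint T * T = T ^+ n * adjoint T * T;
    mpinv T * T ^+ n.+1 * adjoint T = T ^+ n * adjoint T].
  have iii := mpinv_fix_expr_adjoint T_closed_range n1.
  have ii := adjointM_cancel_r T_closed_range.
  by tfae => [/iii/ii|/ii|/iii].
split=> [n n1|].
  have [i [ii iii]] := main n n1; tfae => //.
    by move=> /(n_hypo_EP_mpinv T_closed_range).
  by move=> /iii /(n_hypo_EP_mpinv T_closed_range).
have [i [ii iii]] := main 1%N isT; tfae => //.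
  by move=> /(hypo_EP_mpinv T_closed_range).
by move=> /iii /(hypo_EP_mpinv T_closed_range).
Qed.
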